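(* Let $\Sigma$ be a finite alphabet with at least two letters, and let $n\ge 2$ and $k\ge 1$ be integers with $k<n/2$. Let $(L_1,R_1)$ be a partition of $\Sigma$ into two non-empty parts, and for every $i\in\{2,\dots,k\}$ let $(L_i,R_i)$ be a partition of $\bigcup_{j=1}^{i-1}L_jR_{i-j}$ into two disjoint, possibly empty, parts. Let $X=\bigcup_{i=1}^{k}L_iR_{k+1-i}\subseteq\Sigma^{k+1}$. Then $$C=\bigcup_{\alpha}X\,\Sigma^{n-2k-1}R_{\alpha_1}\cdots R_{\alpha_{\mathrm{par}(\alpha)}}\subseteq\Sigma^n,$$ where $\alpha$ ranges over all compositions of $k$, is simultaneously a $(1,k)$-overlap-free and an $(n-k,n-1)$-overlap-free code.
   Context: For sets of words $L,R$, $LR$ denotes the set of all concatenations $lr$ with $l\in L$, $r\in R$; $\Sigma^m$ is the set of all words of length $m$ over $\Sigma$. A composition of a positive integer $m$ is a tuple $\alpha=(\alpha_1,\dots,\alpha_p)$ of positive integers with sum $m$; $\mathrm{par}(\alpha)=p$ is its number of parts. Two (not necessarily distinct) words $u,v$ have a $t$-overlap if the prefix of $u$ of length $t$ equals the suffix of $v$ of length $t$, or vice versa. A code $C\subseteq\Sigma^n$ is $(t_1,t_2)$-overlap-free if for all $t_1\le t\le t_2$ no two (not necessarily distinct) codewords have a $t$-overlap. *)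

(* Defs.v *)
From mathcomp Require Import all_boot.
From mathcomp Require Import boolp classical_sets.

Set Implicit Arguments.
Unset Strict Implicit.
Unset Printing Implicit Defensive.

Local Open Scope classical_set_scope.

Definition words (S : Type) (m : nat) : set (seq S) := [set w | size w = m].
Arguments words S m : clear implicits.

Definition lcat (S : Type) (A B : set (seq S)) : set (seq S) :=
  [set u ++ v | u in A & v in B].

(* R_(a_1) R_(a_2) ... R_(a_p) *)
Definition lcat_along (S : Type) (R : nat -> set (seq S)) (a : seq nat) :
    set (seq S) :=
  \big[@lcat S/[set [::]]]_(i <- a) R i.

Definition bipartition (T : Type) (A P Q : set T) : Prop :=
  P `|` Q = A /\ P `&` Q = set0.

Definition composition (m : nat) (a : seq nat) : bool :=
  all (fun i => 0 < i) a && (sumn a == m).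

(* Going through the common factor w makes t at most the length of both
   words, with no truncation as there would be with take and drop. *)
Definition overlap (S : eqType) (t : nat) (u v : seq S) : Prop :=
  exists2 w : seq S, size w = t &
    (prefix w u /\ suffix w v) \/ (prefix w v /\ suffix w u).

Definition overlap_free (S : eqType) (t1 t2 : nat) (C : set (seq S)) : Prop :=
  forall t, t1 <= t <= t2 ->
  forall u v, C u -> C v -> ~ overlap t u v.

(* L_1 R_(m-1) U ... U L_(m-1) R_1: the set split into (L_m, R_m) when
   2 <= m <= k, and the set X when m = k + 1. *)
Definition conv (S : Type) (L R : nat -> set (seq S)) (m : nat) :
    set (seq S) :=
  \bigcup_(j in [set j | 1 <= j < m]) lcat (L j) (R (m - j)).

Definition composition_code (S : Type) (L R : nat -> set (seq S)) (n k : nat) :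
    set (seq S) :=
  \bigcup_(a in [set a | composition k a])
    lcat (lcat (conv L R k.+1) (words S (n - 2 * k - 1))) (lcat_along R a).

(* Main.v *)
Require Import Defs.
From mathcomp Require Import all_boot.
From mathcomp Require Import boolp classical_sets.

Set Implicit Arguments.
Unset Strict Implicit.
Unset Printing Implicit Defensive.

Local Open Scope classical_set_scope.

(** Write L^+ and R^+ for the nonempty products of words of the L_i, resp. R_i,
    with i <= k. If a word of some L_j R_(m-j), m <= k+1, is cut into two
    nonempty pieces, then the left piece lies in L^+ and the right one in R^+;
    hence L^+ is closed under nonempty prefixes and R^+ under nonempty
    suffixes, and this forces L^+ and R^+ to be disjoint. A short overlap would
    be a proper prefix of a word of X and a suffix of a word of R^+, thus in
    both. In a long overlap, the word of X that begins one codeword is cut by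
    the beginning of the other one, and its right piece is also a proper prefix
    of a word of X, thus again in both. *)

Inductive plus (S : Type) (k : nat) (F : nat -> set (seq S)) : seq S -> Prop :=
| plus_gen i w : 1 <= i <= k -> F i w -> plus k F w
| plus_cat u v : plus k F u -> plus k F v -> plus k F (u ++ v).

Definition iterated_bipartition (S : Type) (k : nat)
    (L R : nat -> set (seq S)) : Prop :=
  bipartition (words S 1) (L 1) (R 1) /\
  (forall i, 2 <= i <= k -> bipartition (conv L R i) (L i) (R i)).

(** Levi's lemma: the two cut points of the common word are comparable, and [s] is the piece between
    them. *)
Lemma cat_eq_cat (S : Type) (l r u v : seq S) :
  l ++ r = u ++ v ->
  (exists2 s, l = u ++ s & v = s ++ r) \/ (exists2 s, u = l ++ s & r = s ++ v).
Proof.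
elim: l u => [|x l IH] [|y u] /= E.
- by left; exists [::].
- by right; exists (y :: u).
- by left; exists (x :: l).
- case: E => <- /IH[] [s -> ->]; first by left; exists s.
  by right; exists s.
Qed.

(** * The recursive partitions and the lengths of their words *)

Lemma iterated_bipartition_conv (S : Type) (k : nat) (L R : nat -> set (seq S))
    (m : nat) (w : seq S) :
  iterated_bipartition k L R -> 2 <= m <= k -> L m w \/ R m w -> conv L R m w.
Proof. by move=> [_ H] /H[<- _]. Qed.

Lemma iterated_bipartition_disjoint (S : Type) (k : nat)
    (L R : nat -> set (seq S)) (m : nat) (w : seq S) :
  iterated_bipartition k L R -> 1 <= m <= k -> L m w -> R m w -> False.
Proof.
move=> [H1 H] mk Lw Rw.
suff [A D] : exists A, bipartition A (L m) (R m).
  by case: D => _ LR0; have : (L m `&` R m) w by []; rewrite LR0.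
case: m mk {Lw Rw} => [|[|m]] // mk; first by exists (words S 1).
by exists (conv L R m.+2); apply: H.
Qed.

(** Both factors of a word of [conv L R m] have index below [m], so each is a single letter or lies
    in an earlier [conv]; strong induction gives its length. The bound [k.+1] makes the statement
    cover X as well. *)
Lemma conv_size (S : Type) (k : nat) (L R : nat -> set (seq S)) :
  iterated_bipartition k L R ->
  forall m, m <= k.+1 -> conv L R m `<=` words S m.
Proof.
move=> H; elim/ltn_ind => m IH mk w.
have sizeF i v : 1 <= i < m -> L i v \/ R i v -> size v = i.
  move=> /andP[i0 im] LRv; have ik : i <= k by rewrite -ltnS (leq_trans im).
  case: i i0 im ik LRv => [|[|i]] // _ im ik LRv.
    by case: H => -[E _] _; have : (L 1 `|` R 1) v by []; rewrite E.
  apply: IH => //; first exact: ltnW.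
  exact: (iterated_bipartition_conv H _ LRv).
case=> j /= /andP[j0 jm] [l Lj] [r Rj] <-.
rewrite /words /= size_cat (sizeF j) ?j0 //; last by left.
rewrite (sizeF (m - j)) ?subnKC ?(ltnW jm) //; last by right.
by rewrite subn_gt0 jm ltn_subrL j0 (ltn_trans j0 jm).
Qed.

Lemma iterated_bipartition_size (S : Type) (k : nat) (L R : nat -> set (seq S))
    (m : nat) (w : seq S) :
  iterated_bipartition k L R -> 1 <= m <= k -> L m w \/ R m w -> size w = m.
Proof.
move=> H; case: m => [|[|m]] // mk LRw.
  by case: H => -[E _] _; have : (L 1 `|` R 1) w by []; rewrite E.
apply: (conv_size H); first by case/andP: mk => _ /leqW.
exact: (iterated_bipartition_conv H _ LRw).
Qed.

(** * Cutting words into two pieces *)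

Lemma conv_cut (S : Type) (k : nat) (L R : nat -> set (seq S)) :
  iterated_bipartition k L R ->
  forall m u v, m <= k.+1 -> conv L R m (u ++ v) -> u <> [::] -> v <> [::] ->
  plus k L u /\ plus k R v.
Proof.
move=> H; elim/ltn_ind => m IH u v mk + u0 v0.
(* Words of [L i] and of [R i] can be cut alike, since both lie in [conv L R i]. Two nonempty pieces
   force the length [i] to be at least 2, so this [conv] is indeed the set that was split. *)
have cutF i x y : 1 <= i < m -> L i (x ++ y) \/ R i (x ++ y) ->
    x <> [::] -> y <> [::] -> plus k L x /\ plus k R y.
  move=> /andP[i0 im] LRxy x0 y0.
  have ik : i <= k by rewrite -ltnS (leq_trans im).
  apply: (IH i) => //; first exact: ltnW.
  apply: (iterated_bipartition_conv H _ LRxy); rewrite ik andbT.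
  have : size (x ++ y) = i.
    by apply: (iterated_bipartition_size H _ LRxy); rewrite i0.
  by case: x x0 {LRxy} => // a x _; case: y y0 => // b y _ <-;
    rewrite size_cat /= addnS.
case=> j /= /andP[j0 jm] [l Lj] [r Rj] E.
have jk : 1 <= j <= k by rewrite j0 -ltnS (leq_trans jm).
have mjm : 1 <= m - j < m.
  by rewrite subn_gt0 jm ltn_subrL j0 (ltn_trans j0 jm).
have mjk : 1 <= m - j <= k.
  by case/andP: mjm => -> mjm; rewrite -ltnS (leq_trans mjm).
have Ll : plus k L l by apply: plus_gen Lj.
have Rr : plus k R r by apply: plus_gen Rj.
(* The cut falls inside [l], inside [r], or between them. Inside [l], the left piece is in L^+ and
   the remainder [s] of [l] is in R^+, hence so is [s ++ r]; inside [r] it is symmetric. *)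
case: (cat_eq_cat E) => -[s El Ev]; case: s El Ev => [|a s] El Ev.
- by move: El; rewrite Ev cats0 => <-.
- have [Lu Rs] : plus k L u /\ plus k R (a :: s).
    by apply: (cutF j) => //; [rewrite j0 | left; rewrite -El].
  by rewrite Ev; split=> //; apply: plus_cat.
- by move: Ev; rewrite El cats0 => /= <-.
- have [Ls Rv] : plus k L (a :: s) /\ plus k R v.
    by apply: (cutF (m - j)) => //; right; rewrite -Ev.
  by rewrite El; split=> //; apply: plus_cat.
Qed.

Lemma gen_cut (S : Type) (k : nat) (L R : nat -> set (seq S)) (m : nat)
    (u v : seq S) :
  iterated_bipartition k L R -> 1 <= m <= k -> L m (u ++ v) \/ R m (u ++ v) ->
  u <> [::] -> v <> [::] -> plus k L u /\ plus k R v.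
Proof.
move=> H mk LR u0 v0.
have [m2|m1] := leqP 2 m.
  have mk2 : m <= k by case/andP: mk.
  apply: (conv_cut H (leqW mk2)) => //.
  by apply: (iterated_bipartition_conv H _ LR); rewrite m2.
(* For [m = 1] the word is a single letter, which has no cut into two nonempty pieces. *)
have := iterated_bipartition_size H mk LR; rewrite size_cat => E; move: m1.
by rewrite -E; case: u u0 {LR E} => // a u _; case: v v0 => // b v _ /=; rewrite addnS.
Qed.

(** The prefix consists of whole factors, possibly followed by the left piece of a cut factor, which
    is in L^+ by [gen_cut]. *)
Lemma plus_prefix (S : Type) (k : nat) (L R : nat -> set (seq S))
    (u v : seq S) :
  iterated_bipartition k L R -> plus k L (u ++ v) -> u <> [::] -> plus k L u.
Proof.
move=> H; move E: (u ++ v) => w Lw; elim: Lw u v E => {w}.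
  move=> i w ik Lw u v E u0; case: v E => [|b v] E.
    by move: E; rewrite cats0 => ->; apply: plus_gen Lw.
  suff [] : plus k L u /\ plus k R (b :: v) by [].
  by apply: (gen_cut H ik) => //; left; rewrite E.
move=> x y Lx IHx Ly IHy u v /esym /cat_eq_cat[] [s E1 E2] u0.
  exact: (IHx u s).
case: s E1 E2 => [|a s] E1 E2; first by rewrite E1 cats0.
by rewrite E1; apply: plus_cat => //; apply: (IHy (a :: s) v).
Qed.

Lemma plus_suffix (S : Type) (k : nat) (L R : nat -> set (seq S))
    (u v : seq S) :
  iterated_bipartition k L R -> plus k R (u ++ v) -> v <> [::] -> plus k R v.
Proof.
move=> H; move E: (u ++ v) => w Rw; elim: Rw u v E => {w}.
  move=> i w ik Rw u v E v0; case: u E => [|b u] E.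
    by rewrite -[v]cat0s E; apply: plus_gen Rw.
  suff [] : plus k L (b :: u) /\ plus k R v by [].
  by apply: (gen_cut H ik) => //; right; rewrite E.
move=> x y Rx IHx Ry IHy u v /esym /cat_eq_cat[] [s E1 E2] v0; last first.
  exact: (IHy s v).
case: s E1 E2 => [|a s] E1 E2; first by rewrite E2.
by rewrite E2; apply: plus_cat => //; apply: (IHx u (a :: s)).
Qed.

(** * Disjointness of L^+ and R^+ *)

Lemma plus_size_gt0 (S : Type) (k : nat) (L R : nat -> set (seq S))
    (w : seq S) :
  iterated_bipartition k L R -> plus k L w \/ plus k R w -> 0 < size w.
Proof.
move=> H []; elim=> {w} [i w ik Fw|u v _ + _ _]; rewrite ?size_cat ?addn_gt0.
- by rewrite (iterated_bipartition_size H ik) ?(andP ik).1 //; left.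
- by move=> ->.
- by rewrite (iterated_bipartition_size H ik) ?(andP ik).1 //; right.
- by move=> ->.
Qed.

(** Descent on the length: if the word is a proper product in L^+, its right factor is a suffix of a
    word of R^+, hence a shorter common word. If it is a proper product in R^+, its left factor
    serves in the same way. *)
Lemma plus_disjoint (S : Type) (k : nat) (L R : nat -> set (seq S)) :
  iterated_bipartition k L R ->
  forall w, plus k L w -> plus k R w -> False.
Proof.
move=> H w; have [n sz] := ubnP (size w); elim: n w sz => // n IH w sz Lw Rw.
have nil (x : seq S) : 0 < size x -> x <> [::] by case: x.
case: Lw sz Rw => {w} [i w ik Lw|u v Lu Lv] sz Rw; last first.
  have u0 := plus_size_gt0 H (or_introl Lu).
  have v0 := plus_size_gt0 H (or_introl Lv).
  apply: (IH v _ Lv); last exact: (plus_suffix H Rw (nil _ v0)).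
  by move: sz; rewrite size_cat ltnS; apply: leq_trans; rewrite -add1n leq_add2r.
case: Rw sz Lw => {w} [j w jk Rw|u v Ru Rv] sz Lw.
  (* For two generators, comparing lengths gives [i = j], and [L i] and [R i] are disjoint. *)
  apply: (iterated_bipartition_disjoint H ik Lw).
  rewrite -(iterated_bipartition_size H ik (or_introl Lw)).
  by rewrite (iterated_bipartition_size H jk (or_intror Rw)).
have u0 := plus_size_gt0 H (or_intror Ru).
have v0 := plus_size_gt0 H (or_intror Rv).
have Luv : plus k L (u ++ v) by apply: plus_gen Lw.
apply: (IH u _ _ Ru); last exact: (plus_prefix H Luv (nil _ u0)).
by move: sz; rewrite size_cat ltnS; apply: leq_trans; rewrite -addn1 leq_add2l.
Qed.

(** * The shape of codewords *)

Lemma lcat_along_plus (S : Type) (k : nat) (L R : nat -> set (seq S))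
    (a : seq nat) (w : seq S) :
  iterated_bipartition k L R -> all (fun i => 0 < i) a -> sumn a <= k ->
  lcat_along R a w -> size w = sumn a /\ (a <> [::] -> plus k R w).
Proof.
move=> H; elim: a w => [|i a IH] w /=; rewrite /lcat_along.
  by rewrite big_nil => _ _ ->.
move=> /andP[i0 a0] sk; rewrite big_cons => -[u Ru] [v Rv <-].
have ik : 1 <= i <= k by rewrite i0 (leq_trans (leq_addr _ _) sk).
have [sv pv] := IH v a0 (leq_trans (leq_addl _ _) sk) Rv.
rewrite size_cat (iterated_bipartition_size H ik (or_intror Ru)) sv.
split=> // _; have pu : plus k R u by apply: plus_gen Ru.
case: a {IH a0 sk} Rv sv pv => [|j a] Rv sv pv; last by apply: plus_cat => //; apply: pv.
by move/size0nil: sv => ->; rewrite cats0.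
Qed.

(** The composition is forgotten here: of the last block, only its length [k] and its membership in
    R^+ matter for overlaps. *)
Lemma composition_codeE (S : Type) (k n : nat) (L R : nat -> set (seq S))
    (w : seq S) :
  iterated_bipartition k L R -> 1 <= k -> composition_code L R n k w ->
  exists x y z, [/\ w = x ++ y ++ z, conv L R k.+1 x,
    size y = n - 2 * k - 1, size z = k & plus k R z].
Proof.
move=> H k1 [a /= /andP[a0 /eqP sa]] [_ [x Xx [y Yy <-]] [z Zz <-]].
have sk : sumn a <= k by rewrite sa.
have [sz pz] := lcat_along_plus H a0 sk Zz.
exists x, y, z; split; rewrite ?catA ?sz //.
by apply: pz => a_nil; move: k1; rewrite -sa a_nil.
Qed.

Lemma composition_code_size (S : Type) (k n : nat) (L R : nat -> set (seq S)) :
  iterated_bipartition k L R -> 1 <= k -> 2 * k < n ->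
  composition_code L R n k `<=` words S n.
Proof.
move=> H k1 kn w /(composition_codeE H k1)[x [y [z [-> Xx sy sz _]]]].
have sx := conv_size H (leqnn _) Xx.
rewrite /words /= !size_cat sx sy sz -subnDA addn1.
by rewrite addnCA addSn addnn -mul2n subnK.
Qed.

(** The word of X has length [k.+1], so [u] is a proper prefix of it and [conv_cut] applies. The
    remainder [s] of that word is recorded for the long overlaps. *)
Lemma code_prefix_plus (S : Type) (k n : nat) (L R : nat -> set (seq S))
    (u v : seq S) :
  iterated_bipartition k L R -> 1 <= k -> composition_code L R n k (u ++ v) ->
  1 <= size u <= k ->
  plus k L u /\ exists s y, [/\ v = s ++ y, size s = k.+1 - size u & plus k R s].
Proof.
move=> H k1 /(composition_codeE H k1)[x [y [z [E Xx _ _ _]]]] /andP[u0 uk].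
have sx := conv_size H (leqnn _) Xx.
case/esym/cat_eq_cat: E => -[s Ex Ev]; last first.
  by move: uk; rewrite Ex size_cat sx leqNgt leq_addr.
move: sx; rewrite Ex /words /= size_cat => sx.
have [|||Lu Rs] := conv_cut H (leqnn _) (u := u) (v := s); rewrite -?Ex //.
- by move=> un; rewrite un in u0.
- by move=> sn; move: uk; rewrite sn addn0 in sx; rewrite sx ltnn.
by split=> //; exists s, (y ++ z); split; rewrite // -sx addKn.
Qed.

Lemma code_suffix_plus (S : Type) (k n : nat) (L R : nat -> set (seq S))
    (u v : seq S) :
  iterated_bipartition k L R -> 1 <= k -> composition_code L R n k (u ++ v) ->
  1 <= size v <= k -> plus k R v.
Proof.
move=> H k1 /(composition_codeE H k1)[x [y [z [+ _ _ sz Rz]]]] /andP[v0 vk].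
rewrite catA => /esym/cat_eq_cat[] [s E1 E2]; last first.
  rewrite E2 in Rz; apply: (plus_suffix H Rz _) => v_nil.
  by rewrite v_nil in v0.
(* Here [v = s ++ z] with [size z = k], so [size v <= k] makes [s] empty. *)
by move: vk; rewrite E2 size_cat sz -subn_eq0 addnK => /eqP/size0nil ->.
Qed.

(** * Excluding short and long overlaps *)

Lemma code_no_short_overlap (S : eqType) (k n : nat) (L R : nat -> set (seq S))
    (u v w : seq S) :
  iterated_bipartition k L R -> 1 <= k -> composition_code L R n k u ->
  composition_code L R n k v -> 1 <= size w <= k ->
  prefix w u -> suffix w v -> False.
Proof.
move=> H k1 Cu Cv wk /prefixP[u' Eu] /suffixP[v' Ev].
rewrite Eu in Cu; rewrite Ev in Cv.
have [Lw _] := code_prefix_plus H k1 Cu wk.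
exact: (plus_disjoint H Lw (code_suffix_plus H k1 Cv wk)).
Qed.

Lemma code_no_long_overlap (S : eqType) (k n : nat) (L R : nat -> set (seq S))
    (u v w : seq S) :
  iterated_bipartition k L R -> 1 <= k -> 2 * k < n ->
  composition_code L R n k u -> composition_code L R n k v ->
  n - k <= size w <= n.-1 -> prefix w u -> suffix w v -> False.
Proof.
move=> H k1 kn Cu Cv /andP[wk wn] /prefixP[u' Eu] /suffixP[p Ev].
rewrite Eu in Cu; rewrite Ev in Cv.
have := composition_code_size H k1 kn Cv; rewrite /words /= size_cat => sn.
have n0 : 0 < n by apply: leq_ltn_trans kn.
(* The part [p] of [v] before the overlap has length [n - size w], short enough to end inside the
   word of X that begins [v]. *)
have pk : 1 <= size p <= k.
  rewrite -(leq_add2r (size w)) -(leq_add2r (size w) _ k) sn add1n.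
  by rewrite -leq_subLR wk andbT (leq_ltn_trans wn) // prednK.
have [_ [s [y [Ew ss Rs]]]] := code_prefix_plus H k1 Cv pk.
rewrite Ew -catA in Cu.
(* The word of X beginning [v] is [p ++ s], so [size s = k.+1 - size p]. As [s] begins [w], it also
   begins [u], and it is a proper prefix of the word of X there. *)
have sk : 1 <= size s <= k.
  case/andP: pk => p1 pk.
  by rewrite ss subn_gt0 ltnS pk -ltnS ltn_subrL p1.
have [Ls _] := code_prefix_plus H k1 Cu sk.
exact: (plus_disjoint H Ls Rs).
Qed.

Theorem mainTheorem9 (Sigma : finType) (n k : nat)
    (L R : nat -> set (seq Sigma)) :
  2 <= #|Sigma| -> 2 <= n -> 1 <= k -> 2 * k < n ->
  bipartition (words Sigma 1) (L 1) (R 1) ->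
  L 1 !=set0 -> R 1 !=set0 ->
  (forall i, 2 <= i <= k -> bipartition (conv L R i) (L i) (R i)) ->
  [/\ conv L R k.+1 `<=` words Sigma k.+1,
      composition_code L R n k `<=` words Sigma n,
      overlap_free 1 k (composition_code L R n k) &
      overlap_free (n - k) n.-1 (composition_code L R n k)].
Proof.
move=> _ _ k1 kn H1 _ _ H2.
have H : iterated_bipartition k L R by split.
split.
- exact: (conv_size H (leqnn _)).
- exact: composition_code_size.
- move=> t tk u v Cu Cv [w sw]; rewrite -sw in tk; case=> -[pw sf].
  + exact: (code_no_short_overlap H k1 Cu Cv tk).
  + exact: (code_no_short_overlap H k1 Cv Cu tk).
- move=> t tk u v Cu Cv [w sw]; rewrite -sw in tk; case=> -[pw sf].
  + exact: (code_no_long_overlap H k1 kn Cu Cv tk).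
  + exact: (code_no_long_overlap H k1 kn Cv Cu tk).
Qed.
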